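(* Let $q\ge 1$ be fixed and let $\mathbf{\Sigma}$ be a fixed, known $q\times q$ positive definite matrix. For each $n\ge1$ let $\mathbf{X}_n$ be a (deterministic) $n\times p_n$ design matrix, let $\mathbf{B}_0=\mathbf{B}_{0n}\in\mathbb{R}^{p_n\times q}$ be the true coefficient matrix, and let the data be generated as $\mathbf{Y}_n=\mathbf{X}_n\mathbf{B}_0+\mathbf{E}_n$ with $\mathbf{E}_n\sim\mathcal{MN}_{n\times q}(\mathbf{O},\mathbf{I}_n,\mathbf{\Sigma})$; let $\mathbb{P}_0$ denote the distribution of $\{\mathbf{Y}_n\}_{n\ge1}$ under this true model. Let $\pi_n(\mathbf{B}_n)$ be any prior density on $\mathbb{R}^{p_n\times q}$ with distribution $\Pi_n$, and let $\Pi_n(\cdot\mid\mathbf{Y}_n)$ be the posterior under the likelihood $\mathbf{Y}_n\mid\mathbf{B}_n\sim\mathcal{MN}_{n\times q}(\mathbf{X}_n\mathbf{B}_n,\mathbf{I}_n,\mathbf{\Sigma})$. Assume: (A1) $p_n=o(n)$ and $p_n\le n$ for all $n\ge1$; (A2) there are constants $c_1,c_2$ with $0<c_1<\liminf_{n\to\infty}\lambda_{\min}(\mathbf{X}_n^\top\mathbf{X}_n/n)\le\limsup_{n\to\infty}\lambda_{\max}(\mathbf{X}_n^\top\mathbf{X}_n/n)<c_2<\infty$; (A3) there are constants $d_1,d_2$ with $0<d_1<\lambda_{\min}(\mathbf{\Sigma})\le\lambda_{\max}(\mathbf{\Sigma})<d_2<\infty$. Fix $\varepsilon>0$ and suppose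 there is $\rho>0$ such that for all $0<\Delta<\frac{\varepsilon^2c_1d_1^{1/2}}{48c_2^{1/2}d_2}$ and all $0<k<\frac{\varepsilon^2c_1}{32d_2}-\frac{3\Delta c_2^{1/2}}{2d_1^{1/2}}$, $$\Pi_n\Big(\mathbf{B}_n:\ \|\mathbf{B}_n-\mathbf{B}_0\|_F<\frac{\Delta}{n^{\rho/2}}\Big)>\exp(-kn)$$ for all sufficiently large $n$. Then $$\Pi_n\big(\mathbf{B}_n:\ \|\mathbf{B}_n-\mathbf{B}_0\|_F>\varepsilon\ \big|\ \mathbf{Y}_n\big)\to0\quad\text{almost surely }\mathbb{P}_0\text{ as }n\to\infty.$$
   Context: A random matrix $\mathbf{Y}\in\mathbb{R}^{a\times b}$ has the matrix-normal distribution $\mathcal{MN}_{a\times b}(\mathbf{M},\mathbf{U},\mathbf{V})$ (with $\mathbf{M}\in\mathbb{R}^{a\times b}$, $\mathbf{U}$, $\mathbf{V}$ positive definite of sizes $a\times a$, $b\times b$) if it has density $f(\mathbf{Y})=(2\pi)^{-ab/2}|\mathbf{U}|^{-b/2}|\mathbf{V}|^{-a/2}\exp\{-\tfrac12\mathrm{tr}[\mathbf{U}^{-1}(\mathbf{Y}-\mathbf{M})\mathbf{V}^{-1}(\mathbf{Y}-\mathbf{M})^\top]\}$. $\mathbf{O}$ denotes the zero matrix, $\|\cdot\|_F$ the Frobenius norm, and $\lambda_{\min},\lambda_{\max}$ the smallest and largest eigenvalues of a symmetric matrix. The number of predictors $p_n$ may grow with $n$. *)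

(* Defs.v *)
From HB Require Import structures.
From mathcomp Require Import all_boot all_order all_algebra.
From mathcomp Require Import all_classical all_reals all_analysis.
Set Implicit Arguments. Unset Strict Implicit. Unset Printing Implicit Defensive.
Import Order.TTheory GRing.Theory Num.Theory.
Import numFieldNormedType.Exports.
Local Open Scope classical_set_scope.
Local Open Scope ring_scope.

Section Defs.
Variable R : realType.

Definition MX (m n : nat) := g_sigma_algebraType (@open 'M[R]_(m, n)).

(** [mu] is Lebesgue measure on R^{m x n}: it gives every half-open box
    { B | a_ij < B_ij <= b_ij } its volume. (Lebesgue measure is the unique
    Borel measure with this property.) *)
Definition is_lebesgue_mx (m n : nat)
    (mu : {measure set (MX m n) -> \bar R}) : Prop :=
  forall a b : 'M[R]_(m, n), (forall i j, a i j <= b i j) ->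
    mu [set B : MX m n | forall i j, a i j < B i j <= b i j] =
    (\prod_(i < m) \prod_(j < n) (b i j - a i j))%:E.

Definition frob (m n : nat) (A : 'M[R]_(m, n)) : R :=
  Num.sqrt (\sum_(i < m) \sum_(j < n) A i j ^+ 2).

(** Smallest / largest (real) eigenvalue of a square real matrix
    (used only for symmetric matrices, whose eigenvalues are all real). *)
Definition lambda_min (n : nat) (A : 'M[R]_n) : R := inf [set a | eigenvalue A a].
Definition lambda_max (n : nat) (A : 'M[R]_n) : R := sup [set a | eigenvalue A a].

Definition posdef (n : nat) (A : 'M[R]_n) : Prop :=
  A^T = A /\ forall v : 'rV[R]_n, v != 0 -> 0 < (v *m A *m v^T) 0 0.

Definition mn_density (a b : nat) (M : 'M[R]_(a, b)) (U : 'M[R]_a) (V : 'M[R]_b)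
    (Y : 'M[R]_(a, b)) : R :=
  (2 * pi) `^ (- ((a * b)%:R / 2)) * (\det U) `^ (- (b%:R / 2))
  * (\det V) `^ (- (a%:R / 2))
  * expR (- (1 / 2) * \tr (invmx U *m (Y - M) *m invmx V *m (Y - M)^T)).

Definition prior_prob (p q : nat) (lam : {measure set (MX p q) -> \bar R})
    (pi_ : MX p q -> R) (A : set (MX p q)) : \bar R :=
  \int[lam]_(B in A) (pi_ B)%:E.

Definition posterior_prob (n p q : nat) (lam : {measure set (MX p q) -> \bar R})
    (pi_ : MX p q -> R) (X : 'M[R]_(n, p)) (Sigma : 'M[R]_q)
    (Y : 'M[R]_(n, q)) (A : set (MX p q)) : R :=
  fine (\int[lam]_(B in A) (mn_density (X *m B) 1%:M Sigma Y * pi_ B)%:E) /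
  fine (\int[lam]_(B in setT) (mn_density (X *m B) 1%:M Sigma Y * pi_ B)%:E).

End Defs.

(* Main.v *)
Require Import Defs.
From HB Require Import structures.
From mathcomp Require Import all_boot all_order all_algebra.
From mathcomp Require Import all_classical all_reals all_analysis.
From mathcomp Require Import measurable_realfun ring lra.
Set Implicit Arguments. Unset Strict Implicit. Unset Printing Implicit Defensive.
Import Order.TTheory GRing.Theory Num.Theory.
Import numFieldNormedType.Exports.
Local Open Scope classical_set_scope.
Local Open Scope ring_scope.

(** Write [D = B - B0] and let [score Y = X^T Y Sigma^-1].  The likelihood ratio
    of [B] against [B0] is [exp (<D, score E> - |X D|^2 / 2)], where [<,>] is the
    Frobenius product and [|.|] the [Sigma^-1]-norm, and (A2)-(A3) make
    [|X D|^2] comparable with [n |D|_F^2].  As soon as [|score E|_F <= n g] for a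
    small constant [g], the likelihood ratio is exponentially small uniformly on
    [|D|_F > eps] and at least [exp (- small * n)] near [B0], so the posterior
    mass decays exponentially, without any test function.

    The event [|score E|_F > n g] is handled by the method of mixtures: the
    exponential tilts by [<D, score E>] are mixed over a Gaussian weight in [D].
    Tonelli, with translation invariance and scaling of Lebesgue measure, bounds
    the exponential moment of [|score E|_F^2] by [2^(p q)].  Since [p = o(n)] the
    events are summable, and Borel-Cantelli concludes. *)

(** * Borel sets of matrices and uniqueness of Lebesgue measure *)

Section matrix_borel.
Variable R : realType.
Implicit Types m n : nat.

Lemma measurable_coord m n (i : 'I_m) (j : 'I_n) :
  measurable_fun setT (fun B : MX R m n => B i j).
Proof.
apply: (measurability _ (RGenOpens.measurableE R)) => _ [_ [x [y ->]] <-].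
rewrite setTI; apply: sub_sigma_algebra.
by apply: open_comp (itv_open x y) => M _; exact: coord_continuous.
Qed.

Definition mx_box m n (a b : 'M[R]_(m, n)) : set (MX R m n) :=
  [set B | forall i j, a i j < B i j <= b i j].

Definition mx_boxes m n : set (set (MX R m n)) :=
  [set A | exists a b : 'M[R]_(m, n),
     (forall i j, a i j <= b i j) /\ A = mx_box a b].

Lemma measurable_mx_box m n (a b : 'M[R]_(m, n)) : measurable (mx_box a b).
Proof.
rewrite (_ : mx_box a b = \bigcap_(k in [set: 'I_m * 'I_n])
   (fun B : MX R m n => B k.1 k.2) @^-1` `]a k.1 k.2, b k.1 k.2]).
  apply: fin_bigcap_measurable => // k _.
  by rewrite -[X in measurable X]setTI; apply: measurable_coord => //.
apply/seteqP; split => B /=.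
  by move=> Bab [i j] _ /=; rewrite in_itv/=; exact: Bab.
by move=> Bab i j; have := Bab (i, j) Logic.I; rewrite /= in_itv.
Qed.

Lemma setI_closed_mx_boxes m n : setI_closed (@mx_boxes m n).
Proof.
move=> _ _ [a [b [ab ->]]] [a' [b' [ab' ->]]].
pose A : 'M[R]_(m, n) := \matrix_(i, j) Num.max (a i j) (a' i j).
(* The outer maximum with [A] keeps the corners ordered when the two boxes are disjoint; the
   resulting box is then empty. *)
exists A, (\matrix_(i, j) Num.max (A i j) (Num.min (b i j) (b' i j))); split.
  by move=> i j; rewrite [leRHS]mxE le_max lexx.
apply/seteqP; split => B /=.
  move=> [Bab Bab'] i j; rewrite !mxE gt_max le_max le_min.
  by move: (Bab i j) (Bab' i j) => /andP[-> ->] /andP[-> ->]; rewrite orbT.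
move=> BA; split => i j; move: (BA i j); rewrite !mxE gt_max le_max le_min le_max;
  move=> /andP[/andP[aB a'B]]; rewrite !leNgt aB a'B /= -!leNgt.
  by move=> /andP[-> _].
by move=> /andP[_ ->].
Qed.

(* Every open set is a countable union of boxes with rational corners. *)
Lemma measurable_mx_boxesE m n :
  @measurable _ (MX R m n) = <<s @mx_boxes m n >>.
Proof.
apply/seteqP; split; last first.
  apply: smallest_sub; first exact: sigma_algebra_measurable.
  by move=> _ [a [b [_ ->]]]; exact: measurable_mx_box.
apply: smallest_sub; first exact: smallest_sigma_algebra.
move=> U oU.
pose rmx (a : 'M[rat]_(m, n)) : 'M[R]_(m, n) := map_mx ratr a.
pose F (k : 'M[rat]_(m, n) * 'M[rat]_(m, n)) : set (MX R m n) :=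
  (* Pairs of corners that do not fit inside [U] contribute the empty set, so the union may range
     over the whole countable type of pairs. *)
  if pselect (mx_box (rmx k.1) (rmx k.2) `<=` U /\
              forall i j, rmx k.1 i j <= rmx k.2 i j)
  then mx_box (rmx k.1) (rmx k.2) else set0.
rewrite (_ : U = \bigcup_k F k).
  apply: (@countable_bigcupT_measurable _
     (g_sigma_algebraType (@mx_boxes m n))) => // k.
  rewrite /F; case: pselect => [H0|H0]; last exact: measurable0.
  by apply: sub_sigma_algebra; exists (rmx k.1), (rmx k.2); case: H0.
apply/seteqP; split => [B UB|B [k _]]; last first.
  by rewrite /F; case: pselect => // -[kU _] /kU.
have /nbhs_ballP[e /= e0 eU] : nbhs (B : 'M[R]_(m, n)) U by exact: open_nbhs_nbhs.
have a_ i j : {r : rat | (ratr r : R) \in `](B i j - e), (B i j)[}.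
  by apply/cid/rat_in_itvoo; rewrite ltrBlDr ltrDl.
have b_ i j : {r : rat | (ratr r : R) \in `](B i j), (B i j + e)[}.
  by apply/cid/rat_in_itvoo; rewrite ltrDl.
exists (\matrix_(i, j) sval (a_ i j), \matrix_(i, j) sval (b_ i j)) => //.
have BH : mx_box (rmx (\matrix_(i, j) sval (a_ i j)))
              (rmx (\matrix_(i, j) sval (b_ i j))) B.
  move=> i j; rewrite !mxE.
  move: (svalP (a_ i j)) (svalP (b_ i j)); rewrite !in_itv/=.
  by move=> /andP[_ ->] /andP[/ltW].
rewrite /F; case: pselect => //= -[]; split; last first.
  by move=> i j; move: (BH i j) => /andP[/ltW/le_trans]; apply.
move=> C CH; apply: eU; split => // i j; move: (CH i j); rewrite !mxE.
move: (svalP (a_ i j)) (svalP (b_ i j)); rewrite !in_itv/=.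
move=> /andP[Bx _] /andP[_ yB] /andP[xC Cy].
rewrite /ball/= ltr_distlC (lt_trans Bx xC)/=.
exact: le_lt_trans Cy yB.
Qed.

Section lebesgue.
Variables (m n : nat) (mu : {measure set (MX R m n) -> \bar R}).
Hypothesis hmu : is_lebesgue_mx mu.

Let K k : set (MX R m n) := mx_box (const_mx (- k%:R)) (const_mx k%:R).

Lemma mx_boxes_cover : \bigcup_k K k = setT.
Proof.
apply/seteqP; split => // B _.
pose s := \sum_i \sum_j `|(B : 'M[R]_(m, n)) i j|.
exists (Num.bound s) => // i j; rewrite !mxE.
have : `|B i j| < (Num.bound s)%:R.
  apply: le_lt_trans (archi_boundP _); last by rewrite sumr_ge0// => *; rewrite sumr_ge0.
  rewrite /s (bigD1 i)//= (bigD1 j)//= -addrA lerDl addr_ge0// ?sumr_ge0// => *.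
  by rewrite sumr_ge0.
by rewrite ltr_norml => /andP[-> /ltW ->].
Qed.

Lemma mx_boxes_fin k : (mu (K k) < +oo)%E.
Proof.
by rewrite hmu ?ltry// => i j; rewrite !mxE (le_trans (y:=0))// oppr_le0.
Qed.

Lemma mx_boxesK k : @mx_boxes m n (K k).
Proof.
by do 2!eexists; split; last reflexivity;
  move=> i j; rewrite !mxE (le_trans (y:=0))// oppr_le0.
Qed.

Lemma lebesgue_mx_sigma_finite : sigma_finite setT mu.
Proof.
by exists K => [|k]; rewrite ?mx_boxes_cover//; split;
  [exact: measurable_mx_box|exact: mx_boxes_fin].
Qed.

(** Dynkin's argument: the boxes are stable under intersection and generate the Borel sets, and the
    cubes [K k] of finite mass exhaust the space. *)
Lemma lebesgue_mx_unique (nu : {measure set (MX R m n) -> \bar R}) :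
  (forall A, @mx_boxes m n A -> mu A = nu A) ->
  forall A, measurable A -> mu A = nu A.
Proof.
move=> H A mA.
apply: (measure_unique (@mx_boxes m n) K _ _ _ _ mu nu) => //.
- exact: measurable_mx_boxesE.
- exact: setI_closed_mx_boxes.
- exact: mx_boxesK.
- exact: mx_boxes_cover.
- exact: mx_boxes_fin.
Qed.

End lebesgue.
End matrix_borel.

(** Boxes generate the Borel sets, and the preimage of a box is a finite intersection of preimages
    of intervals under the entries. *)
Lemma measurable_to_mx (R : realType) m n d (T : measurableType d)
    (f : T -> MX R m n) :
  (forall i j, measurable_fun setT (fun t => f t i j)) -> measurable_fun setT f.
Proof.
move=> mf; apply: (measurability _ (@measurable_mx_boxesE R m n)) => //.
move=> _ [_ [a [b [_ ->]]] <-].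
rewrite (_ : setT `&` _ = \bigcap_(k in [set: 'I_m * 'I_n])
   (fun t => f t k.1 k.2) @^-1` `]a k.1 k.2, b k.1 k.2]).
  apply: fin_bigcap_measurable => // k _.
  by rewrite -[X in measurable X]setTI; apply: mf.
apply/seteqP; split => t /=.
  by move=> [_ H] [i j] _ /=; rewrite in_itv/=; exact: H.
by move=> H; split => // i j; have := H (i, j) Logic.I; rewrite /= in_itv.
Qed.

(** Tonelli for measures whose sigma-finiteness is a proof rather than part of their type; the
    bundled structures are rebuilt from the hypotheses. *)
Lemma tonelli_sigma_finite (R : realType) d1 d2 (T1 : measurableType d1)
    (T2 : measurableType d2) (m1 : {measure set T1 -> \bar R})
    (m2 : {measure set T2 -> \bar R}) (f : T1 * T2 -> \bar R) :
  sigma_finite setT m1 -> sigma_finite setT m2 ->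
  measurable_fun setT f -> (forall x, 0 <= f x)%E ->
  (\int[m1]_x \int[m2]_y f (x, y) = \int[m2]_y \int[m1]_x f (x, y))%E.
Proof.
move=> s1 s2 mf f0.
pose H1 := isSFinite.Build _ _ _ _ (sfinite_measure_sigma_finite s1).
pose K1 := isSigmaFinite.Build _ _ _ _ s1.
pose m1' := HB.pack_for (SigmaFiniteMeasure.type T1 R) (Measure.sort m1)
  H1 K1.
pose H2 := isSFinite.Build _ _ _ _ (sfinite_measure_sigma_finite s2).
pose K2 := isSigmaFinite.Build _ _ _ _ s2.
pose m2' := HB.pack_for (SigmaFiniteMeasure.type T2 R) (Measure.sort m2)
  H2 K2.
exact: (@fubini_tonelli _ _ _ _ _ m1' m2' f mf f0).
Qed.

(** * Lebesgue measure under scaling and translation *)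

Section affine_change.
Variables (R : realType) (m n : nat) (mu : {measure set (MX R m n) -> \bar R}).
Hypothesis hmu : is_lebesgue_mx mu.
Variables (c : R) (b : 'M[R]_(m, n)).
Hypothesis c0 : 0 < c.

Let phi (B : MX R m n) : MX R m n := c *: (B : 'M[R]_(m, n)) + b.

Lemma measurable_affine_mx : measurable_fun setT phi.
Proof.
apply: measurable_to_mx => i j; rewrite /phi.
under eq_fun do rewrite !mxE.
apply: measurable_funD => //; apply: measurable_funM => //.
exact: measurable_coord.
Qed.

(** Both sides are measures in [A], so boxes suffice; the preimage of a box is a box with each of
    the [m * n] sides divided by [c]. *)
Lemma lebesgue_mx_affine (A : set (MX R m n)) : measurable A ->
  (mu A = (c ^+ (m * n))%:E * mu (phi @^-1` A))%E.
Proof.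
have cmn : 0 <= c ^+ (m * n) by rewrite exprn_ge0// ltW.
pose push : {measure set (MX R m n) -> \bar R} := pushforward mu phi.
pose nu : {measure set (MX R m n) -> \bar R} :=
  mscale (NngNum cmn) (push measurable_affine_mx).
suff H : forall A, @mx_boxes R m n A -> mu A = nu A.
  exact: (@lebesgue_mx_unique _ _ _ mu hmu nu H).
move=> {}A.
move=> [a [a' [aa' ->]]]; rewrite hmu//.
change ((\prod_(i < m) \prod_(j < n) (a' i j - a i j))%:E =
  ((c ^+ (m * n))%:E * mu (phi @^-1` mx_box a a'))%E).
have -> : phi @^-1` mx_box a a' =
          mx_box (c^-1 *: (a - b)) (c^-1 *: (a' - b)).
  apply/seteqP; split => B /= H i j; move: (H i j); rewrite /phi !mxE;
    by rewrite ltr_pdivrMl// ler_pdivlMl// ltrBlDr lerBrDr.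
rewrite hmu; last first.
  by move=> i j; rewrite !mxE ler_pM2l ?invr_gt0// lerB.
rewrite -EFinM; congr (_%:E).
rewrite mulnC exprM -[in c ^+ n](card_ord n) -[in X in _ ^+ X](card_ord m).
rewrite -!prodr_const -big_split/=; apply: eq_bigr => i _.
rewrite -big_split/=; apply: eq_bigr => j _; rewrite !mxE.
by field; rewrite gt_eqF.
Qed.

Lemma ge0_integral_affine (f : MX R m n -> \bar R) :
  measurable_fun setT f -> (forall x, 0 <= f x)%E ->
  (\int[mu]_x f x = (c ^+ (m * n))%:E * \int[mu]_x f (phi x))%E.
Proof.
move=> mf f0.
have cmn : 0 <= c ^+ (m * n) by rewrite exprn_ge0// ltW.
pose push : {measure set (MX R m n) -> \bar R} := pushforward mu phi.
pose nu := push measurable_affine_mx.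
rewrite (eq_measure_integral (mscale (NngNum cmn) nu)).
  rewrite ge0_integral_mscale//; congr (_ * _)%E.
  exact: (ge0_integral_pushforward measurable_affine_mx).
by move=> A mA _; exact: lebesgue_mx_affine.
Qed.

End affine_change.

(** * Weighted Frobenius forms and Rayleigh quotients *)

Section weighted_form.
Variable R : realType.

(** For positive definite [S] this is an inner product, summed over rows; the exponent of the
    matrix-normal density is [- 1 / 2] times its squared norm for the inverse covariance. *)
Definition wform m n (S : 'M[R]_n) (A B : 'M[R]_(m, n)) : R :=
  \tr (A *m S *m B^T).

Section laws.
Variables (m n : nat) (S : 'M[R]_n).
Implicit Types A B C : 'M[R]_(m, n).

Lemma wformDl A B C : wform S (A + B) C = wform S A C + wform S B C.
Proof. by rewrite /wform !mulmxDl mxtraceD. Qed.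

Lemma wformDr A B C : wform S A (B + C) = wform S A B + wform S A C.
Proof. by rewrite /wform linearD mulmxDr mxtraceD. Qed.

Lemma wformZl k A B : wform S (k *: A) B = k * wform S A B.
Proof. by rewrite /wform -!scalemxAl mxtraceZ. Qed.

Lemma wformZr k A B : wform S A (k *: B) = k * wform S A B.
Proof. by rewrite /wform linearZ -scalemxAr mxtraceZ. Qed.

Lemma wformNl A B : wform S (- A) B = - wform S A B.
Proof. by rewrite -scaleN1r wformZl mulN1r. Qed.

Lemma wformNr A B : wform S A (- B) = - wform S A B.
Proof. by rewrite -scaleN1r wformZr mulN1r. Qed.

Lemma wformC A B : S^T = S -> wform S A B = wform S B A.
Proof.
by move=> hS; rewrite /wform -mxtrace_tr !trmx_mul trmxK hS mulmxA.
Qed.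

Lemma wform0l A : wform S 0 A = 0.
Proof. by rewrite /wform !mul0mx mxtrace0. Qed.

Lemma wform0r A : wform S A 0 = 0.
Proof. by rewrite /wform trmx0 mulmx0 mxtrace0. Qed.

Lemma wform_rows A B :
  wform S A B = \sum_i wform S (row i A) (row i B).
Proof.
apply: eq_bigr => i _; rewrite /wform /mxtrace big_ord1.
by rewrite tr_row -!row_mul !mxE; apply: eq_bigr => j _; rewrite !mxE.
Qed.

End laws.

Definition fprod m n (A B : 'M[R]_(m, n)) : R := wform 1%:M A B.

Lemma fprodE m n (A B : 'M[R]_(m, n)) :
  fprod A B = \sum_i \sum_j A i j * B i j.
Proof.
rewrite /fprod /wform mulmx1; apply: eq_bigr => i _; rewrite mxE.
by apply: eq_bigr => j _; rewrite mxE.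
Qed.

Lemma fprodC m n (A B : 'M[R]_(m, n)) : fprod A B = fprod B A.
Proof. by apply: wformC; rewrite trmx1. Qed.

Lemma fprod_ge0 m n (A : 'M[R]_(m, n)) : 0 <= fprod A A.
Proof.
by rewrite fprodE; apply: sumr_ge0 => i _; apply: sumr_ge0 => j _;
  rewrite -expr2 sqr_ge0.
Qed.

Lemma fprod_eq0 m n (A : 'M[R]_(m, n)) : fprod A A = 0 -> A = 0.
Proof.
rewrite fprodE => /eqP; rewrite psumr_eq0; last first.
  by move=> i _; apply: sumr_ge0 => j _; rewrite -expr2 sqr_ge0.
move=> /allP A0; apply/matrixP => i j; rewrite mxE.
have := A0 i (mem_index_enum _); rewrite /= psumr_eq0; last first.
  by move=> k _; rewrite -expr2 sqr_ge0.
by move=> /allP/(_ j (mem_index_enum _))/=; rewrite -expr2 sqrf_eq0 => /eqP.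
Qed.

Lemma frobE m n (A : 'M[R]_(m, n)) : frob A = Num.sqrt (fprod A A).
Proof.
by rewrite /frob fprodE; congr Num.sqrt; apply: eq_bigr => i _;
  apply: eq_bigr => j _; rewrite expr2.
Qed.

Lemma frob_sqr m n (A : 'M[R]_(m, n)) : frob A ^+ 2 = fprod A A.
Proof. by rewrite frobE sqr_sqrtr// fprod_ge0. Qed.

Lemma frob_ge0 m n (A : 'M[R]_(m, n)) : 0 <= frob A.
Proof. by rewrite frobE sqrtr_ge0. Qed.

(** Cauchy-Schwarz, from the nonnegativity of the squared norm of
    [fprod B B *: A - fprod A B *: B]. *)
Lemma fprod_le_frob m n (A B : 'M[R]_(m, n)) :
  `|fprod A B| <= frob A * frob B.
Proof.
rewrite -(@ler_pXn2r _ 2)// ?nnegrE ?mulr_ge0 ?frob_ge0//.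
rewrite exprMn !frob_sqr real_normK ?num_real//.
have [/fprod_eq0 ->|B0] := eqVneq (fprod B B) 0.
  by rewrite /fprod !wform0r expr0n/= mulr0.
have Bp : 0 < fprod B B by rewrite lt_neqAle eq_sym B0 fprod_ge0.
have := fprod_ge0 (fprod B B *: A - fprod A B *: B).
rewrite {1}/fprod !(wformDl, wformDr, wformNl, wformNr, wformZl, wformZr).
rewrite -!/(fprod _ _) (fprodC B A).
set a := fprod A A; set b := fprod B B; set c := fprod A B.
move=> H; have : 0 <= b * (a * b - c ^+ 2) by lra.
by rewrite pmulr_rge0// subr_ge0.
Qed.

End weighted_form.

(** * Rayleigh quotients and extreme eigenvalues *)

Section rayleigh.
Variable R : realType.

Lemma continuous_sum_fun (T : topologicalType) (I : Type) (r : seq I)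
    (f : I -> T -> R) : (forall i, continuous (f i)) ->
  continuous (fun x => \sum_(i <- r) f i x).
Proof.
move=> cf; elim: r => [|i r IH].
  by under eq_fun do rewrite big_nil; exact: cst_continuous.
under eq_fun do rewrite big_cons.
by move=> x; apply: continuousD; [exact: cf|exact: IH].
Qed.

Lemma continuous_wform_diag n (S : 'M[R]_n) :
  continuous (fun v : 'rV[R]_n => wform S v v).
Proof.
have -> : (fun v : 'rV[R]_n => wform S v v) =
    (fun v : 'rV[R]_n => \sum_j \sum_i v 0 i * S i j * v 0 j).
  apply/funext => v; rewrite /wform /mxtrace big_ord1 !mxE.
  by apply: eq_bigr => j _; rewrite !mxE mulr_suml.
apply: continuous_sum_fun => j; apply: continuous_sum_fun => i v.
have cc k : {for v, continuous (fun v : 'rV[R]_n => v 0 k)}.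
  exact: coord_continuous.
apply: (@continuousM _ _ (fun v : 'rV[R]_n => v 0 i * S i j)); last exact: cc.
apply: (@continuousM _ _ (fun v : 'rV[R]_n => v 0 i)); first exact: cc.
exact: cst_continuous.
Qed.

(* The minimum of the Rayleigh quotient on the unit sphere is attained at an
   eigenvector, by comparing with perturbations [c + t *: c M]. *)
Lemma lambda_min_rayleigh n (A : 'M[R]_n) : A^T = A ->
  forall v : 'rV[R]_n, lambda_min A * fprod v v <= wform A v v.
Proof.
case: n A => [|n] A hA v.
  by rewrite (thinmx0 v) /fprod !wform0l mulr0.
pose S := [set v : 'rV[R]_n.+1 | fprod v v = 1].
have cS : compact S.
  apply: bounded_closed_compact; last first.
    apply: (@preimage_closed _ _ (fun v : 'rV[R]_n.+1 => fprod v v) [set 1]).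
      by move=> x _; exact: continuous_wform_diag.
    exact: closed_eq.
  exists 1; split; first exact: num_real.
  move=> x x1 u /= Su; rewrite [leLHS]/Num.Def.normr /= mx_normrE.
  apply/bigmax_leP; split => [|[i j] _ /=]; first by rewrite ltW// (lt_trans ltr01).
  rewrite (le_trans _ (ltW x1))// -(@ler_pXn2r _ 2)// ?nnegrE//.
  rewrite expr1n real_normK ?num_real// -Su fprodE (bigD1 i)//= (bigD1 j)//=.
  rewrite -addrA expr2 lerDl addr_ge0// ?sumr_ge0// => *.
    by rewrite -expr2 sqr_ge0.
  by rewrite sumr_ge0// => *; rewrite -expr2 sqr_ge0.
have S0 : S !=set0.
  exists (delta_mx 0 0); rewrite /S/= fprodE big_ord1 (bigD1 0)//= big1.
    by rewrite addr0 !mxE !eqxx mulr1.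
  by move=> j /negbTE j0; rewrite !mxE j0 andbF mul0r.
have cf : {within S, continuous (fun v : 'rV[R]_n.+1 => wform A v v)}.
  by apply: continuous_subspaceT; exact: continuous_wform_diag.
have [c Sc cmin] := compact_EVT_min S0 cS cf.
move: Sc; rewrite inE /S/= => Sc.
set mn := wform A c c in cmin.
have ray (u : 'rV[R]_n.+1) : mn * fprod u u <= wform A u u.
  have [/fprod_eq0 ->|u0] := eqVneq (fprod u u) 0.
    by rewrite /fprod !wform0l mulr0.
  have up : 0 < fprod u u by rewrite lt_neqAle eq_sym u0 fprod_ge0.
  set k := Num.sqrt (fprod u u).
  have k2 : k * k = fprod u u by rewrite -expr2 sqr_sqrtr// ltW.
  have k0 : k != 0 by rewrite gt_eqF// sqrtr_gt0.
  (* Homogeneity carries the minimum over the sphere to every nonzero [u]. *)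
  have := cmin (k^-1 *: u); rewrite inE /S/= /fprod !wformZl !wformZr.
  rewrite -!/(fprod _ _) -k2 => /(_ _)/wrap[|].
    by field.
  by move=> H; rewrite -ler_pdivlMr ?k2// -k2 (le_trans H)//
    le_eqVlt; apply/orP; left; apply/eqP; field.
have eig : eigenvalue A mn.
  apply/eigenvalueP; exists c; last first.
    apply: contra_eq_neq Sc => ->.
    by rewrite /fprod wform0l eq_sym oner_neq0.
  apply/eqP; rewrite -subr_eq0; apply/eqP/fprod_eq0.
  (* [w] is the residual of the eigenvalue equation at the minimiser; if it were nonzero, moving
     from [c] along [- w] would decrease the quotient below its minimum. *)
  have [w wE] : {w | w = c *m A - mn *: c} by eexists.
  rewrite -wE; apply/eqP; rewrite eq_le fprod_ge0 andbT leNgt.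
  apply/negP => wp.
  have Acw : wform A c w - mn * fprod c w = fprod w w.
    rewrite [X in _ = fprod X _]wE /fprod wformDl wformNl wformZl.
    by congr (_ - _); rewrite /wform mulmx1.
  set K := wform A w w - mn * fprod w w.
  set h := fprod w w in wp Acw *.
  have q t : 0 <= t * (2 * h + t * K).
    have := ray (c + t *: w); rewrite -subr_ge0 /fprod.
    rewrite !(wformDl, wformDr, wformZl, wformZr) -!/(fprod _ _).
    rewrite -/mn (wformC w c hA) (fprodC w c) Sc -/h.
    by rewrite /K -/h; have := Acw; rewrite -/(fprod c w) => Acw' H; nra.
  (* At [t = - h / (|K| + 1)] the linear term dominates: [q] would give
     [2 * h <= h * K / (|K| + 1) <= h], against [0 < h]. *)
  have := q (- (h / (`|K| + 1))).
  have K1 : 0 < `|K| + 1 by rewrite ltr_wpDl.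
  rewrite mulNr oppr_ge0 pmulr_rle0 ?divr_gt0// => H.
  have : h / (`|K| + 1) * K <= h.
    rewrite mulrAC ler_pdivrMr// ler_pM2l//.
    by rewrite (le_trans (ler_norm K))// lerDl.
  by move: H; rewrite mulNr; lra.
apply: le_trans (ray v); apply: ler_wpM2r; first exact: fprod_ge0.
(* [ge_inf] needs the spectrum bounded below: each eigenvalue is a Rayleigh quotient, hence at least
   [mn]. *)
apply: ge_inf => //; exists mn => a /= /eigenvalueP[u uA u0].
have up : 0 < fprod u u.
  rewrite lt_neqAle fprod_ge0 andbT eq_sym.
  by apply: contra u0 => /eqP/fprod_eq0 ->.
have -> : mn <= a = (mn * fprod u u <= a * fprod u u) by rewrite ler_pM2r.
suff -> : a * fprod u u = wform A u u by exact: ray.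
by rewrite -wformZl /wform mulmx1 uA.
Qed.

Lemma lambda_max_opp n (A : 'M[R]_n) : lambda_max A = - lambda_min (- A).
Proof.
rewrite /lambda_max /lambda_min /inf opprK; congr sup.
apply/seteqP; split => a /=.
  move=> /eigenvalueP[v vA v0]; exists (- a); last by rewrite opprK.
  by apply/eigenvalueP; exists v => //; rewrite mulmxN vA scaleNr.
move=> [b /eigenvalueP[v vA v0] <-]; apply/eigenvalueP; exists v => //.
by rewrite scaleNr -vA mulmxN opprK.
Qed.

Lemma lambda_min_le_wform m n (A : 'M[R]_n) (W : 'M[R]_(m, n)) : A^T = A ->
  lambda_min A * fprod W W <= wform A W W.
Proof.
move=> hA; rewrite /fprod 2!wform_rows mulr_sumr; apply: ler_sum => i _.
exact: lambda_min_rayleigh.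
Qed.

Lemma wform_le_lambda_max m n (A : 'M[R]_n) (W : 'M[R]_(m, n)) : A^T = A ->
  wform A W W <= lambda_max A * fprod W W.
Proof.
move=> hA; rewrite lambda_max_opp mulNr lerNr.
have -> : - wform A W W = wform (- A) W W.
  by rewrite /wform mulmxN mulNmx raddfN.
by apply: lambda_min_le_wform; rewrite linearN/= hA.
Qed.

Lemma mul_fprod_le_wform m n (A : 'M[R]_n) (W : 'M[R]_(m, n)) (c : R) :
  A^T = A -> c <= lambda_min A -> c * fprod W W <= wform A W W.
Proof.
move=> hA cA; apply: le_trans (lambda_min_le_wform W hA).
by apply: ler_wpM2r cA; exact: fprod_ge0.
Qed.

Lemma wform_le_mul_fprod m n (A : 'M[R]_n) (W : 'M[R]_(m, n)) (c : R) :
  A^T = A -> lambda_max A <= c -> wform A W W <= c * fprod W W.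
Proof.
move=> hA Ac; apply: le_trans (wform_le_lambda_max W hA) _.
by apply: ler_wpM2r Ac; exact: fprod_ge0.
Qed.

End rayleigh.

(** * Comparing the forms of [S] and of its inverse *)

Section inverse_form.
Variables (R : realType) (q : nat) (S : 'M[R]_q).
Hypothesis hS : posdef S.

Lemma posdef_unitmx : S \in unitmx.
Proof.
rewrite unitmxE unitfE; apply/negP => /det0P[v v0 vS].
by have := hS.2 v v0; rewrite vS mul0mx mxE ltxx.
Qed.

Lemma invmx_sym : (invmx S)^T = invmx S.
Proof. by rewrite trmx_inv hS.1. Qed.

Lemma wform_diag_ge0 m (W : 'M[R]_(m, q)) : 0 <= wform S W W.
Proof.
rewrite wform_rows sumr_ge0// => i _; rewrite /wform /mxtrace big_ord1.
have [->|W0] := eqVneq (row i W) 0; first by rewrite !mul0mx mxE.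
exact/ltW/hS.2.
Qed.

Let wform_mulinv m (A B : 'M[R]_(m, q)) :
  wform S (A *m invmx S) B = fprod A B.
Proof. by rewrite /fprod /wform mulmx1 mulmxKV// posdef_unitmx. Qed.

Lemma wform_invmx m (A B : 'M[R]_(m, q)) :
  wform (invmx S) A B = wform S (A *m invmx S) (B *m invmx S).
Proof. by rewrite wform_mulinv /fprod /wform mulmx1 trmx_mul invmx_sym mulmxA. Qed.

(** With [V = W *m invmx S], expand [|d V - W|^2 >= 0] and bound [d |V|^2] by [wform S V V], which
    equals [wform (invmx S) W W]. *)
Lemma wform_invmx_le m (W : 'M[R]_(m, q)) (d : R) : 0 < d ->
  (forall V : 'M[R]_(m, q), d * fprod V V <= wform S V V) ->
  d * wform (invmx S) W W <= fprod W W.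
Proof.
move=> d0 hd; have := hd (W *m invmx S); rewrite -wform_invmx.
have : wform (invmx S) W W = fprod (W *m invmx S) W.
  by rewrite /fprod /wform mulmx1.
set V := W *m invmx S; set t := wform (invmx S) W W => tE H.
have := fprod_ge0 (d *: V - W).
rewrite {1}/fprod !(wformDl, wformDr, wformNl, wformNr, wformZl, wformZr).
rewrite -!/(fprod _ _) (fprodC W V) -tE.
have := ler_wpM2l (ltW d0) H; lra.
Qed.

(** The dual expansion: [d *: (W *m invmx S) - W] in the form of [S], where the cross term is
    [fprod W W]. *)
Lemma wform_invmx_ge m (W : 'M[R]_(m, q)) (d : R) : 0 < d ->
  wform S W W <= d * fprod W W ->
  fprod W W <= d * wform (invmx S) W W.
Proof.
move=> d0 hd; have := wform_diag_ge0 (d *: (W *m invmx S) - W).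
rewrite !(wformDl, wformDr, wformNl, wformNr, wformZl, wformZr).
rewrite -wform_invmx (wformC _ (_ *m _) hS.1) wform_mulinv => H.
by rewrite -(ler_pM2l d0); lra.
Qed.

End inverse_form.

(** * Measurability of matrix-valued maps *)

Section measurable_matrices.
Variables (R : realType) (d : measure_display) (T : measurableType d).

Definition measurable_entries m n (f : T -> 'M[R]_(m, n)) :=
  forall i j, measurable_fun setT (fun t => f t i j).

Lemma measurable_entries_mull m n k (A : 'M[R]_(m, n)) (f : T -> 'M[R]_(n, k)) :
  measurable_entries f -> measurable_entries (fun t => A *m f t).
Proof.
move=> mf i j; under eq_fun do rewrite mxE.
by apply: measurable_sum => l; apply: measurable_funM => //; exact: mf.
Qed.

Lemma measurable_entries_mulr m n k (A : 'M[R]_(n, k)) (f : T -> 'M[R]_(m, n)) :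
  measurable_entries f -> measurable_entries (fun t => f t *m A).
Proof.
move=> mf i j; under eq_fun do rewrite mxE.
by apply: measurable_sum => l; apply: measurable_funM => //; exact: mf.
Qed.

Lemma measurable_entriesB m n (f g : T -> 'M[R]_(m, n)) :
  measurable_entries f -> measurable_entries g ->
  measurable_entries (fun t => f t - g t).
Proof.
move=> mf mg i j; under eq_fun do rewrite !mxE.
by apply: measurable_funB; [exact: mf|exact: mg].
Qed.

Lemma measurable_wform m n (S : 'M[R]_n) (f g : T -> 'M[R]_(m, n)) :
  measurable_entries f -> measurable_entries g ->
  measurable_fun setT (fun t => wform S (f t) (g t)).
Proof.
move=> mf mg; rewrite /wform /mxtrace; apply: measurable_sum => i.
under eq_fun do rewrite mxE; apply: measurable_sum => j.
apply: measurable_funM; first exact: (measurable_entries_mulr S mf i j).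
by under eq_fun do rewrite mxE; exact: mg.
Qed.

Lemma measurable_frob m n (f : T -> 'M[R]_(m, n)) :
  measurable_entries f -> measurable_fun setT (fun t => frob (f t)).
Proof.
move=> mf; under eq_fun do rewrite frobE.
apply: (measurableT_comp (continuous_measurable_fun (@sqrt_continuous R))).
exact: measurable_wform.
Qed.

Lemma measurable_EFin_expR (f : T -> R) : measurable_fun setT f ->
  measurable_fun setT (fun t => (expR (f t))%:E).
Proof.
by move=> mf; apply/measurable_EFinP; apply: measurableT_comp.
Qed.

End measurable_matrices.

(** * Gaussian integrals over matrices *)

Section gaussian.
Variable R : realType.

Lemma measurable_entries_id m n :
  measurable_entries (fun B : MX R m n => B : 'M[R]_(m, n)).
Proof. by move=> i j; exact: measurable_coord. Qed.

Definition mn_const n q (S : 'M[R]_q) : R :=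
  (2 * pi) `^ (- ((n * q)%:R / 2)) * (\det S) `^ (- (n%:R / 2)).

Lemma mn_densityE n q (M Y : 'M[R]_(n, q)) (S : 'M[R]_q) :
  mn_density M 1%:M S Y =
  mn_const n S * expR (- (1 / 2) * wform (invmx S) (Y - M) (Y - M)).
Proof.
rewrite /mn_density /mn_const /wform invmx1 mul1mx det1 powR1 mulr1.
by [].
Qed.

Lemma mn_const_gt0 n q (S : 'M[R]_q) : posdef S -> 0 < mn_const n S.
Proof.
move=> /posdef_unitmx; rewrite unitmxE unitfE => S0.
rewrite /mn_const mulr_gt0//; first by rewrite powR_gt0// mulr_gt0// pi_gt0.
(* [powR] is an exponential at every nonzero base, so invertibility of [S] settles positivity
   without the sign of its determinant. *)
by rewrite /powR (negbTE S0) expR_gt0.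
Qed.

Section on_lebesgue.
Variables (m n : nat) (mu : {measure set (MX R m n) -> \bar R}).
Hypothesis hmu : is_lebesgue_mx mu.

(** For [t > 0] this is [(pi / t)] to the power [m n / 2]. The value is never computed: scaling in
    [t], finiteness and positivity suffice. *)
Definition gaussian_mass (t : R) : \bar R :=
  (\int[mu]_B (expR (- t * fprod (B : 'M[R]_(m, n)) B))%:E)%E.

Lemma measurable_expR_fprod (t : R) : measurable_fun setT
  (fun B : MX R m n => (expR (- t * fprod (B : 'M[R]_(m, n)) B))%:E).
Proof.
apply: measurable_EFin_expR; apply: measurable_funM => //.
by apply: measurable_wform; exact: measurable_entries_id.
Qed.

Lemma gaussian_mass_scale (c t : R) : 0 < c ->
  gaussian_mass t = ((c ^+ (m * n))%:E * gaussian_mass (c ^+ 2 * t))%E.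
Proof.
move=> c0; rewrite {1}/gaussian_mass (ge0_integral_affine hmu 0 c0).
- congr (_ * _)%E; apply: eq_integral => B _; congr (expR _)%:E.
  by rewrite addr0 {1}/fprod wformZl wformZr -/(fprod _ _); ring.
- exact: measurable_expR_fprod.
- by move=> B; rewrite lee_fin expR_ge0.
Qed.

Variables (S : 'M[R]_n) (d1 d2 : R).
Hypotheses (hS : posdef S) (d10 : 0 < d1) (d20 : 0 < d2).
Hypotheses
  (S1 : forall W : 'M[R]_(m, n), d1 * fprod W W <= wform S W W)
  (S2 : forall W : 'M[R]_(m, n), wform S W W <= d2 * fprod W W).
Hypothesis mass1 : (\int[mu]_Y (mn_density 0 1%:M S Y)%:E = 1)%E.

Let K := mn_const m S.
Let K0 : 0 < K. Proof. exact: mn_const_gt0. Qed.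

Lemma measurable_mn_density (M : 'M[R]_(m, n)) :
  measurable_fun setT (fun Y : MX R m n => (mn_density M 1%:M S Y)%:E).
Proof.
under eq_fun do rewrite mn_densityE.
apply/measurable_EFinP.
apply: measurable_funM => //; apply: measurableT_comp => //.
apply: measurable_funM => //.
apply: measurable_wform; apply: measurable_entriesB => //;
  exact: measurable_entries_id.
Qed.

Lemma mn_density_ge0 (M Y : 'M[R]_(m, n)) : 0 <= mn_density M 1%:M S Y.
Proof. by rewrite mn_densityE mulr_ge0 ?expR_ge0// ltW. Qed.

(** The bounds on [S] squeeze the normalized density between two spherical Gaussians with the same
    constant [K]. *)
Lemma gaussian_mass_sandwich :
  (K%:E * gaussian_mass (2 * d1)^-1 <= 1 <= K%:E * gaussian_mass (2 * d2)^-1)%E.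
Proof.
rewrite /gaussian_mass -!ge0_integralZl//; first 1 last.
- exact: measurable_expR_fprod.
- by rewrite lee_fin ltW.
- exact: measurable_expR_fprod.
- by rewrite lee_fin ltW.
rewrite -mass1; apply/andP; split; apply: ge0_le_integral => //.
- by move=> B _; rewrite lee_fin mulr_ge0 ?expR_ge0// ltW.
- by apply: measurable_funeM; exact: measurable_expR_fprod.
- exact: measurable_mn_density.
- move=> B _; rewrite mn_densityE subr0 lee_fin ler_pM2l// ler_expR.
  rewrite !mulNr lerN2.
  have := wform_invmx_le hS (B : 'M[R]_(m, n)) d10 S1.
  rewrite -ler_pdivlMl// => H.
  rewrite (le_trans (ler_wpM2l _ H))// invfM; lra.
- by move=> B _; rewrite lee_fin mn_density_ge0.
- exact: measurable_mn_density.
- by apply: measurable_funeM; exact: measurable_expR_fprod.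
- move=> B _; rewrite mn_densityE subr0 lee_fin ler_pM2l// ler_expR.
  rewrite !mulNr lerN2.
  have := wform_invmx_ge hS d20 (S2 (B : 'M[R]_(m, n))).
  rewrite -ler_pdivrMl// => H.
  rewrite (le_trans _ (ler_wpM2l _ H))// invfM; lra.
Qed.

(** Scaling ties the masses at any two positive rates by a positive factor, so finiteness comes from
    the rate for [d1] and positivity from the rate for [d2]. *)
Lemma gaussian_mass_fin (t : R) : 0 < t ->
  exists2 r : R, 0 < r & gaussian_mass t = r%:E.
Proof.
move=> t0; have /andP[H1 H2] := gaussian_mass_sandwich.
have M0 s : (0 <= gaussian_mass s)%E.
  by apply: integral_ge0 => B _; rewrite lee_fin expR_ge0.
have scale s : 0 < s -> exists2 c, 0 < c & gaussian_mass s = (c%:E * gaussian_mass t)%E.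
  move=> s0; exists (Num.sqrt (t / s) ^+ (m * n)).
    by rewrite exprn_gt0// sqrtr_gt0 divr_gt0.
  rewrite (gaussian_mass_scale s (c := Num.sqrt (t / s))) ?sqrtr_gt0 ?divr_gt0//.
  by rewrite sqr_sqrtr ?divr_ge0 ?ltW// divfK ?gt_eqF.
have [a a0 aE] := scale (2 * d1)^-1 ltac:(by rewrite invr_gt0 mulr_gt0).
have [b b0 bE] := scale (2 * d2)^-1 ltac:(by rewrite invr_gt0 mulr_gt0).
move: (M0 t) H1 H2; rewrite aE bE.
case: (gaussian_mass t) => [r| |]//.
  rewrite lee_fin => r0 _; rewrite -!EFinM lee_fin => H; exists r => //.
  rewrite lt_neqAle r0 andbT; apply: contraTneq H => <-.
  by rewrite !mulr0 -ltNge.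
by rewrite !gt0_muley ?lte_fin.
Qed.

(* Completing the square turns the tilted density into a translate. *)
Lemma mn_density_mgf (V : 'M[R]_(m, n)) :
  (\int[mu]_Y (expR (wform (invmx S) V Y) * mn_density 0 1%:M S Y)%:E =
   (expR (1 / 2 * wform (invmx S) V V))%:E)%E.
Proof.
transitivity (\int[mu]_Y ((expR (1 / 2 * wform (invmx S) V V))%:E *
   (mn_density 0 1%:M S (1 *: (Y : 'M[R]_(m, n)) + - V))%:E))%E.
  apply: eq_integral => Y _; rewrite -EFinM; congr (_%:E).
  rewrite !mn_densityE !subr0 mulrCA [RHS]mulrCA -!expRD; congr (_ * expR _).
  rewrite scale1r !(wformDl, wformDr, wformNl, wformNr).
  rewrite (wformC (S := invmx S) Y V (invmx_sym hS)); lra.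
rewrite ge0_integralZl//.
- have := ge0_integral_affine hmu (- V) ltr01 (measurable_mn_density 0).
  rewrite mass1 expr1n mul1e => <-; first by rewrite mule1.
  by move=> ?; rewrite lee_fin mn_density_ge0.
- apply: (measurableT_comp (measurable_mn_density 0)).
  exact: (measurable_affine_mx 1 (- V)).
- by move=> ? _; rewrite lee_fin mn_density_ge0.
Qed.

End on_lebesgue.
End gaussian.

(** * Exponential moments of the score *)

Section score_tail.
Variables (R : realType) (n p q : nat).
Variables (mu : {measure set (MX R n q) -> \bar R})
  (lam : {measure set (MX R p q) -> \bar R}).
Hypotheses (hmu : is_lebesgue_mx mu) (hlam : is_lebesgue_mx lam).
Variables (S : 'M[R]_q) (d1 d2 : R).
Hypotheses (hS : posdef S) (d10 : 0 < d1) (d20 : 0 < d2).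
Hypotheses
  (S1 : forall m (W : 'M[R]_(m, q)), d1 * fprod W W <= wform S W W)
  (S2 : forall m (W : 'M[R]_(m, q)), wform S W W <= d2 * fprod W W).
Hypotheses (mu1 : (\int[mu]_Y (mn_density 0 1%:M S Y)%:E = 1)%E)
  (lam1 : (\int[lam]_Y (mn_density 0 1%:M S Y)%:E = 1)%E).
Variable X : 'M[R]_(n, p).

(** The gradient of the log likelihood at the true coefficients, as a function of the error [Y]. *)
Definition score (Y : 'M[R]_(n, q)) : 'M[R]_(p, q) := X^T *m Y *m invmx S.

Lemma measurable_score d (T : measurableType d) (f : T -> 'M[R]_(n, q)) :
  measurable_entries f -> measurable_entries (fun t => score (f t)).
Proof.
by move=> mf; apply: measurable_entries_mulr; exact: measurable_entries_mull.
Qed.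

Lemma measurable_score_gt (x : R) :
  measurable [set Y : MX R n q | x < frob (score Y)].
Proof.
have mf : measurable_fun setT (fun Y : MX R n q => frob (score Y)).
  by apply: measurable_frob; apply: measurable_score; exact: measurable_entries_id.
by have := mf measurableT _ (measurable_itv `]x, +oo[);
  rewrite setTI (_ : _ @^-1` _ = [set Y : MX R n q | x < frob (score Y)])//;
  apply/seteqP; split => Y; rewrite /= in_itv/= andbT.
Qed.

Lemma wform_score (D : 'M[R]_(p, q)) (Y : 'M[R]_(n, q)) :
  wform (invmx S) (X *m D) Y = fprod D (score Y).
Proof.
rewrite /fprod /wform /score mulmx1 !trmx_mul trmxK (invmx_sym hS).
by rewrite -!mulmxA mxtrace_mulC !mulmxA.
Qed.

Variable tau : R.
Hypothesis tau0 : 0 < tau.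
Hypothesis hX : forall D : 'M[R]_(p, q),
  wform (invmx S) (X *m D) (X *m D) <= tau * fprod D D.

(* [tilt Y] mixes the exponential tilts of [mn_density_mgf] over Gaussian
   directions [D]; integrating out [D] leaves the exponential of the squared
   norm of the score. *)
Let tilt (Y : 'M[R]_(n, q)) (D : 'M[R]_(p, q)) : R :=
  expR (fprod D (score Y) - tau * fprod D D).

Let int_tilt (Y : 'M[R]_(n, q)) :
  (\int[lam]_D (tilt Y D)%:E =
   (expR (fprod (score Y) (score Y) / (4 * tau)))%:E * gaussian_mass lam tau)%E.
Proof.
(* [- b] maximises the exponent of [tilt Y] in [D]; translating by [b] centres the Gaussian
   there. *)
rewrite /gaussian_mass; set b := - ((2 * tau)^-1 *: score Y).
rewrite [X in (_ * X)%E](ge0_integral_affine hlam b ltr01); last 2 first.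
- exact: measurable_expR_fprod.
- by move=> B; rewrite lee_fin expR_ge0.
rewrite expr1n mul1e -ge0_integralZl//; first 1 last.
- apply: (measurableT_comp (measurable_expR_fprod tau)).
  exact: (measurable_affine_mx 1 b).
apply: eq_integral => D _; rewrite -EFinM -expRD; congr (expR _)%:E.
rewrite /b scale1r.
have -> s : fprod (D - s *: score Y) (D - s *: score Y) =
    fprod D D - 2 * s * fprod D (score Y) + s ^+ 2 * fprod (score Y) (score Y).
  rewrite /fprod !(wformDl, wformDr, wformNl, wformNr, wformZl, wformZr).
  by rewrite -!/(fprod _ _) (fprodC (score Y) D); ring.
by field; rewrite gt_eqF.
Qed.

Let measurable_joint : measurable_fun setT
  (fun z : MX R n q * MX R p q =>
     (tilt z.1 z.2 * mn_density 0 1%:M S (z.1 : 'M[R]_(n, q)))%:E).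
Proof.
have m1 : measurable_entries (fun z : MX R n q * MX R p q => z.1 : 'M[R]_(n, q)).
  move=> i j; exact: (measurableT_comp (measurable_coord i j) measurable_fst).
have m2 : measurable_entries (fun z : MX R n q * MX R p q => z.2 : 'M[R]_(p, q)).
  move=> i j; exact: (measurableT_comp (measurable_coord i j) measurable_snd).
apply/measurable_EFinP; apply: measurable_funM.
  apply: measurableT_comp => //; apply: measurable_funB.
    by apply: measurable_wform => //; exact: measurable_score.
  by apply: measurable_funM => //; exact: measurable_wform.
apply/measurable_EFinP.
exact: (measurableT_comp (measurable_mn_density S 0) measurable_fst).
Qed.

(** Multiplied by the mass [g] at rate [tau], the integrand becomes an integral of [tilt] over [D].
    After the exchange of integrals the inner one is a moment generating function, whose exponent
    [hX] bounds by half of [tau * fprod D D]. *)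
Lemma integral_expR_score :
  (\int[mu]_Y (expR (fprod (score Y) (score Y) / (4 * tau))
     * mn_density 0 1%:M S Y)%:E <= (2 ^+ (p * q))%:E)%E.
Proof.
have [g g0 gE] := gaussian_mass_fin hlam hS d10 d20 (@S1 p) (@S2 p) lam1 tau0.
have dens0 Y := mn_density_ge0 hS (0 : 'M[R]_(n, q)) Y.
have mL : measurable_fun setT (fun Y : MX R n q =>
    (expR (fprod (score Y) (score Y) / (4 * tau)) * mn_density 0 1%:M S Y)%:E).
  apply/measurable_EFinP; apply: measurable_funM; last first.
    by apply/measurable_EFinP; exact: (measurable_mn_density S 0).
  apply: measurableT_comp => //; apply: measurable_funM => //.
  by apply: measurable_wform; apply: measurable_score;
    exact: measurable_entries_id.
rewrite -(@lee_pmul2r _ g%:E) ?lte_fin// -ge0_integralZr//; last 2 first.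
- by move=> Y _; rewrite lee_fin mulr_ge0 ?expR_ge0.
- by rewrite lee_fin ltW.
have -> : (\int[mu]_Y ((expR (fprod (score Y) (score Y) / (4 * tau)) *
      mn_density 0 1%:M S Y)%:E * g%:E) =
    \int[mu]_Y \int[lam]_D (tilt Y D * mn_density 0 1%:M S Y)%:E)%E.
  apply: eq_integral => Y _.
  rewrite EFinM muleAC -gE -int_tilt -ge0_integralZr//.
  - apply/measurable_EFinP; apply: measurableT_comp => //.
    apply: measurable_funB.
      by apply: measurable_wform => //; exact: measurable_entries_id.
    by apply: measurable_funM => //; apply: measurable_wform;
      exact: measurable_entries_id.
  - by move=> D _; rewrite lee_fin expR_ge0.
  - by rewrite lee_fin.
have -> : (\int[mu]_Y \int[lam]_D (tilt Y D * mn_density 0 1%:M S Y)%:E =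
    \int[lam]_D \int[mu]_Y (tilt Y D * mn_density 0 1%:M S Y)%:E)%E.
  apply: (tonelli_sigma_finite (lebesgue_mx_sigma_finite hmu)
    (lebesgue_mx_sigma_finite hlam) measurable_joint) => z.
  by rewrite lee_fin mulr_ge0 ?expR_ge0.
have -> : (\int[lam]_D \int[mu]_Y (tilt Y D * mn_density 0 1%:M S Y)%:E =
    \int[lam]_D (expR (1 / 2 * wform (invmx S) (X *m D) (X *m D)
                      - tau * fprod (D : 'M[R]_(p, q)) D))%:E)%E.
  apply: eq_integral => D _.
  transitivity (\int[mu]_Y ((expR (- (tau * fprod (D : 'M[R]_(p, q)) D)))%:E *
      (expR (wform (invmx S) (X *m D) Y) * mn_density 0 1%:M S Y)%:E))%E.
    apply: eq_integral => Y _.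
    by rewrite /tilt expRD wform_score -EFinM [in RHS]mulrCA [in RHS]mulrA.
  rewrite ge0_integralZl//.
  - by rewrite (mn_density_mgf hmu hS mu1) -EFinM -expRD addrC.
  - apply/measurable_EFinP; apply: measurable_funM; last first.
      by apply/measurable_EFinP; exact: (measurable_mn_density S 0).
    apply: measurableT_comp => //.
    by apply: measurable_wform => //; exact: measurable_entries_id.
  - by move=> Y _; rewrite lee_fin mulr_ge0 ?expR_ge0.
(* The rate left over is [tau / 2]; weakening it to [tau / 4] lets the scaling [c = 2] return to
   [tau] with the exact factor [2 ^+ (p * q)]. *)
apply: (@le_trans _ _ (gaussian_mass lam (tau / 4))); last first.
  rewrite (gaussian_mass_scale hlam _ (c := 2))// (_ : 2 ^+ 2 * _ = tau) ?gE//.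
  by field.
apply: ge0_le_integral => //.
- apply: measurable_EFin_expR; apply: measurable_funB; apply: measurable_funM => //.
    by apply: measurable_wform; apply: measurable_entries_mull;
      exact: measurable_entries_id.
  by apply: measurable_wform; exact: measurable_entries_id.
- exact: measurable_expR_fprod.
move=> D _; rewrite lee_fin ler_expR.
have := hX D; have := mulr_ge0 (ltW tau0) (fprod_ge0 D); lra.
Qed.

(** Markov's inequality for the exponential moment of the squared score. *)
Lemma score_tail (x : R) : 0 <= x ->
  (\int[mu]_(Y in [set Y : MX R n q | (x < frob (score Y))%R])
     (mn_density 0 1%:M S Y)%:E
   <= (2 ^+ (p * q) * expR (- (x ^+ 2 / (4 * tau))))%:E)%E.
Proof.
move=> x0; set A := [set Y | _].
have dens0 Y := mn_density_ge0 hS (0 : 'M[R]_(n, q)) Y.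
have ms : measurable_fun setT (fun Y : MX R n q => fprod (score Y) (score Y)).
  by apply: measurable_wform; apply: measurable_score; exact: measurable_entries_id.
have mA : measurable A by exact: measurable_score_gt.
pose h (Y : MX R n q) := ((expR (- (x ^+ 2 / (4 * tau))))%:E *
  (expR (fprod (score Y) (score Y) / (4 * tau)) * mn_density 0 1%:M S Y)%:E)%E.
have mh : measurable_fun setT (fun Y : MX R n q =>
   (expR (fprod (score Y) (score Y) / (4 * tau)) * mn_density 0 1%:M S Y)%:E).
  apply/measurable_EFinP; apply: measurable_funM; last first.
    by apply/measurable_EFinP; exact: (measurable_mn_density S 0).
  by apply: measurableT_comp => //; apply: measurable_funM.
have h0 Y : (0 <= h Y)%E.
  by rewrite /h -EFinM lee_fin mulr_ge0 ?expR_ge0// mulr_ge0 ?expR_ge0.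
have mh' : measurable_fun setT h by exact: measurable_funeM.
apply: (@le_trans _ _ (\int[mu]_(Y in A) h Y)%E).
  apply: ge0_le_integral => //.
  - by move=> Y _; rewrite lee_fin.
  - by apply: measurable_funTS; exact: (measurable_mn_density S 0).
  - exact: measurable_funTS.
  move=> Y AY; rewrite /h -EFinM lee_fin mulrA -expRD ler_peMl// -expR0 ler_expR.
  rewrite addrC -mulrBl mulr_ge0// ?invr_ge0 ?mulr_ge0 ?ltW//.
  by rewrite subr_gt0 -frob_sqr ltr_pXn2r// nnegrE frob_ge0.
apply: (@le_trans _ _ (\int[mu]_Y h Y)%E); first exact: ge0_subset_integral.
rewrite ge0_integralZl//; last first.
  by move=> Y _; rewrite lee_fin mulr_ge0 ?expR_ge0.
rewrite [X in (_ <= X%:E)%E]mulrC EFinM.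
rewrite lee_pmul2l ?lte_fin ?expR_gt0//.
exact: integral_expR_score.
Qed.

End score_tail.

(** * Likelihood ratios and posterior mass *)

Section posterior_bound.
Variables (R : realType) (n p q : nat).
Variables (lam : {measure set (MX R p q) -> \bar R}).
Variables (pi_ : MX R p q -> R).
Hypotheses (mpi : measurable_fun setT pi_) (pi0 : forall B, 0 <= pi_ B)
  (pi1 : (\int[lam]_(B in setT) (pi_ B)%:E = 1)%E).
Variables (S : 'M[R]_q) (hS : posdef S).
Variables (X : 'M[R]_(n, p)) (B0 : 'M[R]_(p, q)) (E : 'M[R]_(n, q)).

Let like (B : MX R p q) : R := mn_density (X *m B) 1%:M S (X *m B0 + E).
Let like0 : R := mn_density 0 1%:M S E.

Let like0_gt0 : 0 < like0.
Proof. by rewrite /like0 mn_densityE mulr_gt0 ?expR_gt0// mn_const_gt0. Qed.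

(** Expanding the square, the error enters the ratio only through the cross term, which is a pairing
    with the score. *)
Lemma mn_density_ratio (B : 'M[R]_(p, q)) :
  mn_density (X *m B) 1%:M S (X *m B0 + E) = like0 *
  expR (fprod (B - B0) (score S X E) -
        1 / 2 * wform (invmx S) (X *m (B - B0)) (X *m (B - B0))).
Proof.
rewrite /like0 !mn_densityE -mulrA -expRD; congr (_ * expR _).
have -> : X *m B0 + E - X *m B = E - X *m (B - B0).
  by rewrite mulmxBr opprB addrA (addrC E).
rewrite -(wform_score hS) subr0; set V := X *m _.
rewrite !(wformDl, wformDr, wformNl, wformNr) (wformC E V (invmx_sym hS)); lra.
Qed.

Let measurable_like_prior :
  measurable_fun setT (fun B : MX R p q => (like B * pi_ B)%:E).
Proof.
apply/measurable_EFinP; apply: measurable_funM => //.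
rewrite /like; under eq_fun do rewrite mn_densityE.
apply: measurable_funM => //; apply: measurableT_comp => //.
apply: measurable_funM => //.
by apply: measurable_wform; apply: measurable_entriesB => //;
  apply: (measurable_entries_mull X (f := fun B : MX R p q => B : 'M[R]_(p, q)));
  exact: measurable_entries_id.
Qed.

Let measurable_prior : measurable_fun setT (fun B : MX R p q => (pi_ B)%:E).
Proof. exact/measurable_EFinP. Qed.

Let like_ge0 B : 0 <= like B.
Proof. exact: mn_density_ge0. Qed.

Let measurable_dist : measurable_fun setT
  (fun B : MX R p q => frob ((B : 'M[R]_(p, q)) - B0)).
Proof.
apply: measurable_frob; apply: measurable_entriesB => //.
exact: measurable_entries_id.
Qed.

(** Total prior mass 1 bounds the numerator, the ball of mass above [m] bounds the denominator from
    below, and [like0] cancels. *)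
Lemma posterior_prob_le (a b m eps delta : R) : 0 < m ->
  (forall B : 'M[R]_(p, q), eps < frob (B - B0) -> like B <= like0 * expR (- a)) ->
  (forall B : 'M[R]_(p, q), frob (B - B0) < delta -> like0 * expR (- b) <= like B) ->
  (m%:E < prior_prob lam pi_ [set B : MX R p q | (frob (B - B0) < delta)%R])%E ->
  0 <= posterior_prob lam pi_ X S (X *m B0 + E)
         [set B : MX R p q | eps < frob (B - B0)] <= expR (b - a) / m.
Proof.
move=> m0 far near mass; rewrite /posterior_prob -/like.
set A : set (MX R p q) := [set B | eps < _].
have mA : measurable A.
  rewrite (_ : A = setT `&` (fun B : MX R p q =>
      frob ((B : 'M[R]_(p, q)) - B0)) @^-1` `]eps, +oo[).
    exact: (measurable_dist measurableT (measurable_itv _)).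
  by apply/seteqP; split => B; rewrite /A /= in_itv/= andbT; tauto.
move: mass; set C : set (MX R p q) := [set B | _] => mass.
have mC : measurable C.
  rewrite (_ : C = setT `&` (fun B : MX R p q =>
      frob ((B : 'M[R]_(p, q)) - B0)) @^-1` `]-oo, delta[).
    exact: (measurable_dist measurableT (measurable_itv _)).
  by apply/seteqP; split => B; rewrite /C /= in_itv/=; tauto.
set num := (\int[lam]_(B in A) _)%E; set den := (\int[lam]_(B in setT) _)%E.
have L0 c : 0 < like0 * expR c := mulr_gt0 like0_gt0 (expR_gt0 c).
have lp0 B : (0 <= (like B * pi_ B)%:E)%E by rewrite lee_fin mulr_ge0.
have num0 : (0 <= num)%E.
  by apply: integral_ge0 => B _; exact: lp0.
have numle : (num <= (like0 * expR (- a))%:E)%E.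
  apply: (@le_trans _ _ (\int[lam]_(B in A)
      ((like0 * expR (- a))%:E * (pi_ B)%:E))%E).
    apply: ge0_le_integral => //.
    - by move=> B _; exact: lp0.
    - exact: measurable_funTS.
    - by apply: measurable_funTS; exact: measurable_funeM.
    - move=> B AB; rewrite -EFinM lee_fin; apply: ler_wpM2r => //; exact: far.
  rewrite ge0_integralZl//; last 3 first.
  - exact: measurable_funTS.
  - by move=> B _; rewrite lee_fin.
  - by rewrite lee_fin ltW.
  rewrite -[leRHS]mule1 lee_pmul2l ?lte_fin ?L0// -pi1.
  by apply: ge0_subset_integral => // B _; rewrite lee_fin.
have denge : ((like0 * expR (- b) * m)%:E <= den)%E.
  apply: (@le_trans _ _ (\int[lam]_(B in C)
      ((like0 * expR (- b))%:E * (pi_ B)%:E))%E).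
    rewrite ge0_integralZl//; last 3 first.
    - exact: measurable_funTS.
    - by move=> B _; rewrite lee_fin.
    - by rewrite lee_fin ltW.
    rewrite EFinM lee_pmul2l ?lte_fin ?L0//.
    exact: ltW.
  apply: (@le_trans _ _ (\int[lam]_(B in C) (like B * pi_ B)%:E)%E).
    apply: ge0_le_integral => //.
    - by move=> B _; rewrite -EFinM lee_fin mulr_ge0// ltW.
    - by apply: measurable_funTS; exact: measurable_funeM.
    - exact: measurable_funTS.
    - by move=> B CB; rewrite -EFinM lee_fin; apply: ler_wpM2r => //; exact: near.
  apply: ge0_subset_integral => // B _; exact: lp0.
(* [fine] sends an infinite value to 0, so finiteness matters: the likelihood is at most
   [mn_const n S] and the prior has mass 1. *)
have denfin : (den < +oo)%E.
  apply: (@le_lt_trans _ _ (\int[lam]_(B in setT)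
      ((mn_const n S)%:E * (pi_ B)%:E))%E).
    apply: ge0_le_integral => //.
    - by move=> B _; exact: lp0.
    - exact: measurable_funeM.
    - move=> B _; rewrite -EFinM lee_fin; apply: ler_wpM2r => //.
      rewrite /like mn_densityE; apply: ler_piMr; first exact/ltW/mn_const_gt0.
      rewrite -[leRHS]expR0 ler_expR mulNr oppr_le0 mulr_ge0//.
      by rewrite (wform_invmx hS) wform_diag_ge0.
  rewrite ge0_integralZl//; last 2 first.
  - by move=> B _; rewrite lee_fin.
  - by rewrite lee_fin ltW ?mn_const_gt0.
  by rewrite pi1 mule1 ltry.
have r0 : 0 < like0 * expR (- b) * m by rewrite mulr_gt0 ?L0.
have numfin : num \is a fin_num.
  by rewrite ge0_fin_numE// (le_lt_trans numle) ?ltry.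
have denfn : den \is a fin_num.
  by rewrite ge0_fin_numE// (le_trans _ denge)// lee_fin ltW.
rewrite -(fineK numfin) lee_fin in numle.
rewrite -(fineK denfn) lee_fin in denge.
have den0 : 0 < fine den by exact: lt_le_trans denge.
apply/andP; split; first by rewrite divr_ge0 ?(ltW den0)// fine_ge0.
rewrite ler_pdivrMr//.
apply: (le_trans numle); apply: le_trans (ler_wpM2l _ denge); last first.
  by rewrite divr_ge0 ?expR_ge0// ltW.
rewrite expRB expRN [leRHS](_ : _ = like0 * (expR a)^-1)//.
by rewrite expRN; field; rewrite !gt_eqF ?expR_gt0.
Qed.

End posterior_bound.

(** Beyond [eps], the bound on [s] makes the linear term at most half of the quadratic one, leaving
    at most [- lo * eps ^+ 2 / 4]. Within [delta], the exponent is at least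
    [- (delta * s + hi * delta ^+ 2 / 2)]. *)
Lemma posterior_prob_le_score (R : realType) n p q
    (lam : {measure set (MX R p q) -> \bar R}) (pi_ : MX R p q -> R)
    (S : 'M[R]_q) (X : 'M[R]_(n, p)) (B0 : 'M[R]_(p, q)) (E : 'M[R]_(n, q))
    (lo hi s eps delta m : R) :
  measurable_fun setT pi_ -> (forall B, 0 <= pi_ B) ->
  (\int[lam]_(B in setT) (pi_ B)%:E = 1)%E -> posdef S ->
  (forall D : 'M[R]_(p, q),
     lo * fprod D D <= wform (invmx S) (X *m D) (X *m D) <= hi * fprod D D) ->
  0 <= hi -> 0 <= lo -> 0 < eps -> frob (score S X E) <= s -> s <= lo * eps / 4 ->
  0 < m ->
  (m%:E < prior_prob lam pi_ [set B : MX R p q | (frob (B - B0) < delta)%R])%E ->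
  0 <= posterior_prob lam pi_ X S (X *m B0 + E)
         [set B : MX R p q | (eps < frob (B - B0))%R]
    <= expR (delta * s + hi * delta ^+ 2 / 2 - lo * eps ^+ 2 / 4) / m.
Proof.
move=> mpi pi0 pi1 hS hX hi0 lo0 eps0 Gs sle m0 mass.
have s0 : 0 <= s := le_trans (frob_ge0 _) Gs.
have Gabs (D : 'M[R]_(p, q)) : `|fprod D (score S X E)| <= frob D * s.
  by rewrite (le_trans (fprod_le_frob _ _))// ler_wpM2l// frob_ge0.
apply: (posterior_prob_le mpi pi0 pi1 hS m0 _ _ mass) => // B; rewrite mn_density_ratio//;
  (set l := mn_density 0 _ _ _ => HB; have l0 : 0 <= l by exact: mn_density_ge0);
  apply: ler_wpM2l => //; rewrite ler_expR;
  have := hX (B - B0); have := Gabs (B - B0); rewrite -frob_sqr ler_norml;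
  set G := fprod _ _; set w := wform _ _ _; set f := frob _ in HB *;
  move=> /andP[G1 G2] /andP[w1 w2].
  have : f * s <= f * (lo * f / 4).
    apply: ler_wpM2l; first exact: frob_ge0.
    rewrite (le_trans sle)// ler_pM2r// ler_wpM2l// ltW//.
  have : lo * eps ^+ 2 <= lo * f ^+ 2.
    by apply: ler_wpM2l => //; rewrite ler_pXn2r// ?nnegrE ltW// (lt_trans eps0).
  nra.
have f0 : 0 <= f by exact: frob_ge0.
have : f * s <= delta * s by apply: ler_wpM2r => //; exact: ltW.
have : hi * f ^+ 2 <= hi * delta ^+ 2.
  apply: ler_wpM2l => //; rewrite ler_pXn2r ?nnegrE// ?ltW//.
  exact: le_lt_trans HB.
lra.
Qed.

(** * Eventual bounds and Borel-Cantelli *)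

Section eventually.
Variable R : realType.

Lemma limn_esup_lt_near (u : (\bar R)^nat) (c : \bar R) :
  (limn_esup u < c)%E -> \forall n \near \oo, (u n < c)%E.
Proof.
rewrite /limn_esup limf_esupE => /ereal_inf_lt[_ [V FV <-] Vc].
apply: filterS FV => n Vn; apply: le_lt_trans Vc.
by apply: ereal_sup_ubound; exists n.
Qed.

Lemma limn_einf_gt_near (u : (\bar R)^nat) (c : \bar R) :
  (c < limn_einf u)%E -> \forall n \near \oo, (c < u n)%E.
Proof.
rewrite /limn_einf lteNr => /limn_esup_lt_near; apply: filterS => n.
by rewrite lteN2.
Qed.

Lemma geometric_nneseries_lt_pinfty (x : R) : 0 < x -> x < 1 ->
  (\sum_(n <oo) (x ^+ n)%:E < +oo)%E.
Proof.
move=> x0 x1; apply: (@le_lt_trans _ _ (1 * (1 - x)^-1)%:E); last exact: ltry.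
apply: lime_le.
  by apply: is_cvg_nneseries => n _ _; rewrite lee_fin exprn_ge0// ltW.
apply: nearW => n; rewrite sumEFin lee_fin.
have := @geometric_le_lim R n 1 x ler01 x0.
rewrite (ger0_norm (ltW x0)) => /(_ x1).
rewrite /series/=; apply: le_trans; rewrite le_eqVlt; apply/orP; left.
by apply/eqP; apply: eq_bigr => i _; rewrite /geometric/= mul1r.
Qed.

Lemma borel_cantelli_geometric d (T : measurableType d) (P : probability T R)
    (F : nat -> set T) (x : R) : (forall n, measurable (F n)) ->
  0 < x -> x < 1 -> (\forall n \near \oo, (P (F n) <= (x ^+ n)%:E)%E) ->
  {ae P, forall w, \forall n \near \oo, ~ F n w}.
Proof.
(* Emptying the events before [N] makes the geometric bound hold at every index and leaves the upper
   limit of the events unchanged. *)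
move=> mF x0 x1 [N _ PF]; pose F' n := if (n < N)%N then set0 else F n.
have mF' n : measurable (F' n) by rewrite /F'; case: ifP.
exists (lim_sup_set F'); split.
- by apply: bigcap_measurable => // n _; exact: bigcup_measurable.
- apply: lim_sup_set_cvg0 => //.
  apply: le_lt_trans (geometric_nneseries_lt_pinfty x0 x1).
  apply: lee_nneseries => // n _; rewrite /F'; case: ltnP => [_|Nn].
    by rewrite measure0 lee_fin exprn_ge0// ltW.
  exact: PF.
- move=> w /= H n _; apply: contrapT => Hn; apply: H.
  exists (maxn n N) => // k /= nk Fk; apply: Hn; exists k => /=.
    by rewrite (leq_trans (leq_maxl n N)).
  by rewrite /F' ltnNge (leq_trans (leq_maxr n N)).
Qed.

End eventually.

(** * Eigenvalue bounds for the design *)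

Section spectral_bounds.
Variable R : realType.

Lemma lambda_min_le_max n (A : 'M[R]_n) : (0 < n)%N -> A^T = A ->
  lambda_min A <= lambda_max A.
Proof.
case: n A => // n A _ hA; pose v : 'rV[R]_n.+1 := delta_mx 0 0.
have v0 : 0 < fprod v v.
  rewrite lt_neqAle fprod_ge0 andbT eq_sym.
  apply: contra_neq (oner_neq0 R) => /fprod_eq0/matrixP/(_ 0 0).
  by rewrite !mxE !eqxx.
rewrite -(ler_pM2r v0); apply: (@le_trans _ _ (wform A v v)).
  exact: lambda_min_le_wform.
exact: wform_le_lambda_max.
Qed.

(** The spectrum is empty, so [inf] takes its default value; a positive lower bound on [lambda_min]
    thus forces a positive dimension. *)
Lemma lambda_min0 n (A : 'M[R]_n) : n = 0%N -> lambda_min A = 0.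
Proof.
move=> n0; subst n; rewrite /lambda_min (_ : [set _ | _] = set0) ?inf0//.
by apply/seteqP; split => // a /eigenvalueP[v _]; rewrite (thinmx0 v) eqxx.
Qed.

Lemma gram_sym n p (X : 'M[R]_(n, p)) (k : R) :
  (k *: (X^T *m X))^T = k *: (X^T *m X).
Proof. by rewrite linearZ/= trmx_mul trmxK. Qed.

(** The Gram matrix acts on the columns of [D] while [wform] acts on rows, hence the transposes. *)
Lemma fprod_gram n p q (X : 'M[R]_(n, p)) (D : 'M[R]_(p, q)) : (0 < n)%N ->
  fprod (X *m D) (X *m D) = n%:R * wform (n%:R^-1 *: (X^T *m X)) D^T D^T.
Proof.
move=> n0; rewrite /fprod /wform mulmx1 trmx_mul trmxK -scalemxAr -scalemxAl.
rewrite mxtraceZ mulrA divff ?pnatr_eq0 -?lt0n// mul1r.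
by rewrite mxtrace_mulC !mulmxA.
Qed.

Lemma fprod_tr m n (A : 'M[R]_(m, n)) : fprod A^T A^T = fprod A A.
Proof. by rewrite /fprod /wform !mulmx1 trmxK mxtrace_mulC. Qed.

(** The eigenvalues of [S] compare the weighted norm of [X *m D] with its Frobenius norm; those of
    the Gram matrix compare the latter with [D]. *)
Lemma design_bounds n p q (X : 'M[R]_(n, p)) (S : 'M[R]_q) (c1 c2 d1 d2 : R) :
  posdef S -> 0 < d1 -> d1 < lambda_min S -> 0 < d2 -> lambda_max S < d2 ->
  (0 < n)%N -> c1 < lambda_min (n%:R^-1 *: (X^T *m X)) ->
  lambda_max (n%:R^-1 *: (X^T *m X)) < c2 ->
  forall D : 'M[R]_(p, q),
    n%:R * c1 / d2 * fprod D D <= wform (invmx S) (X *m D) (X *m D)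
      <= n%:R * c2 / d1 * fprod D D.
Proof.
move=> hS d10 S1 d20 S2 n0 X1 X2 D.
have := wform_invmx_le hS (X *m D) d10
  (fun W => mul_fprod_le_wform W hS.1 (ltW S1)).
have := wform_invmx_ge hS d20 (wform_le_mul_fprod (X *m D) hS.1 (ltW S2)).
rewrite fprod_gram//; set g := wform (_ *: _) _ _ => H1 H2.
have g1 : c1 * fprod D D <= g.
  by rewrite -(fprod_tr D); apply: mul_fprod_le_wform (gram_sym _ _) (ltW X1).
have g2 : g <= c2 * fprod D D.
  by rewrite -(fprod_tr D); apply: wform_le_mul_fprod (gram_sym _ _) (ltW X2).
have n0' : 0 <= n%:R :> R by [].
apply/andP; split.
  rewrite mulrAC ler_pdivrMr// [leRHS]mulrC; apply: le_trans H1.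
  by rewrite -mulrA ler_wpM2l.
rewrite [leRHS]mulrAC ler_pdivlMr// mulrC; apply: (le_trans H2).
by rewrite -mulrA ler_wpM2l.
Qed.

End spectral_bounds.

(** * Consistency *)

(** At [x = n g] and [tau = n c] the exponent in [score_tail] is twice [n g^2 / (8 c)]; one half
    absorbs the factor [2 ^+ (p * q)], which is at most [expR (p * q)]. *)
Lemma score_event_bound (R : realType) n p q
    (mu : {measure set (MX R n q) -> \bar R})
    (lam : {measure set (MX R p q) -> \bar R}) (S : 'M[R]_q)
    (X : 'M[R]_(n, p)) (d1 d2 c g : R) :
  is_lebesgue_mx mu -> is_lebesgue_mx lam -> posdef S ->
  0 < d1 -> d1 < lambda_min S -> lambda_max S < d2 -> 0 < d2 ->
  (\int[mu]_Y (mn_density 0 1%:M S Y)%:E = 1)%E ->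
  (\int[lam]_Y (mn_density 0 1%:M S Y)%:E = 1)%E ->
  (0 < n)%N -> 0 < c -> 0 <= g ->
  (forall D : 'M[R]_(p, q),
     wform (invmx S) (X *m D) (X *m D) <= n%:R * c * fprod D D) ->
  (p * q)%:R <= n%:R * (g ^+ 2 / (8 * c)) ->
  (\int[mu]_(Y in [set Y : MX R n q | (n%:R * g < frob (score S X Y))%R])
     (mn_density 0 1%:M S Y)%:E
   <= (expR (- (g ^+ 2 / (8 * c))) ^+ n)%:E)%E.
Proof.
move=> hmu hlam hS d10 S1 S2 d20 mu1 lam1 n0 c0 g0 hX hpq.
have n0' : 0 < n%:R :> R by rewrite ltr0n.
have lb m (W : 'M[R]_(m, q)) := mul_fprod_le_wform W hS.1 (ltW S1).
have ub m (W : 'M[R]_(m, q)) := wform_le_mul_fprod W hS.1 (ltW S2).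
have ng0 : 0 <= n%:R * g by rewrite mulr_ge0.
apply: le_trans (score_tail hmu hlam hS d10 d20 lb ub mu1 lam1
  (mulr_gt0 n0' c0) hX ng0) _.
rewrite lee_fin -expRM_natl.
apply: (@le_trans _ _ (expR (p * q)%:R * expR (- ((n%:R * g) ^+ 2 / (4 * (n%:R * c)))))).
  apply: ler_wpM2r; first exact: expR_ge0.
  rewrite -[in leRHS](mulr1 (p * q)%:R) expRM_natl lerXn2r ?nnegrE ?expR_ge0//.
  by have := @expR_ge1Dx R 1; lra.
rewrite -expRD ler_expR.
have -> : (n%:R * g) ^+ 2 / (4 * (n%:R * c)) = 2 * (n%:R * (g ^+ 2 / (8 * c))).
  by field; rewrite !gt_eqF.
by rewrite mulrN; lra.
Qed.

Theorem theorem1 (R : realType)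
  (* Lebesgue measure on each matrix space R^{m x n} *)
  (lam : forall m n : nat, {measure set (MX R m n) -> \bar R})
  (hlam : forall m n : nat, is_lebesgue_mx (lam m n))
  (* fixed response dimension q >= 1 and known covariance Sigma *)
  (q : nat) (hq : (0 < q)%N)
  (Sigma : 'M[R]_q) (hSigma : posdef Sigma)
  (* designs, true coefficients *)
  (p : nat -> nat) (X : forall n : nat, 'M[R]_(n, p n))
  (B0 : forall n : nat, 'M[R]_(p n, q))
  (* the probability space carrying the errors E_n ~ MN(O, I_n, Sigma) *)
  (d : measure_display) (Omega : measurableType d) (P : probability Omega R)
  (E : forall n : nat, Omega -> MX R n q)
  (hEmeas : forall n : nat, measurable_fun setT (E n))
  (hElaw : forall (n : nat) (A : set (MX R n q)), measurable A ->
     (P (E n @^-1` A) = \int[lam n q]_(Y in A) (mn_density 0 1%:M Sigma Y)%:E)%E)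
  (* prior densities *)
  (pi_ : forall n : nat, MX R (p n) q -> R)
  (hpi_meas : forall n : nat, measurable_fun setT (pi_ n))
  (hpi_ge0 : forall (n : nat) (B : MX R (p n) q), 0 <= pi_ n B)
  (hpi_1 : forall n : nat, (\int[lam (p n) q]_(B in setT) (pi_ n B)%:E = 1)%E)
  (* (A1) *)
  (hA1o : (fun n : nat => (p n)%:R / n%:R : R) @ \oo --> (0 : R))
  (hA1le : forall n : nat, (0 < n)%N -> (p n <= n)%N)
  (* (A2) *)
  (c1 c2 : R) (hc1 : 0 < c1)
  (hA2min : (c1%:E < limn_einf
      (fun n : nat => (lambda_min ((n%:R)^-1 *: ((X n)^T *m X n)))%:E))%E)
  (hA2max : (limn_esup
      (fun n : nat => (lambda_max ((n%:R)^-1 *: ((X n)^T *m X n)))%:E) < c2%:E)%E)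
  (* (A3) *)
  (d1 d2 : R) (hd1 : 0 < d1) (hA3min : d1 < lambda_min Sigma)
  (hA3max : lambda_max Sigma < d2)
  (* prior mass condition *)
  (eps : R) (heps : 0 < eps)
  (hprior : exists2 rho : R, 0 < rho &
     forall Delta : R, 0 < Delta ->
       Delta < eps ^+ 2 * c1 * Num.sqrt d1 / (48 * Num.sqrt c2 * d2) ->
     forall k : R, 0 < k ->
       k < eps ^+ 2 * c1 / (32 * d2) - 3 * Delta * Num.sqrt c2 / (2 * Num.sqrt d1) ->
     \forall n \near \oo,
       ((expR (- (k * n%:R)))%:E <
        prior_prob (lam (p n) q) (pi_ n)
          [set B : MX R (p n) q | (frob (B - B0 n) < Delta / (n%:R `^ (rho / 2)))%R])%E) :
  {ae P, forall w : Omega,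
     (fun n : nat => posterior_prob (lam (p n) q) (pi_ n) (X n) Sigma
        (X n *m B0 n + E n w)
        [set B : MX R (p n) q | eps < frob (B - B0 n)]) @ \oo --> (0 : R)}.
Proof.
have d20 : 0 < d2.
  apply: lt_trans hd1 (lt_trans hA3min (le_lt_trans _ hA3max)).
  exact: lambda_min_le_max hSigma.1.
have spec : \forall n \near \oo, [/\ (0 < n)%N,
    c1 < lambda_min (n%:R^-1 *: ((X n)^T *m X n)) &
    lambda_max (n%:R^-1 *: ((X n)^T *m X n)) < c2].
  have h1 := limn_einf_gt_near hA2min; have h2 := limn_esup_lt_near hA2max.
  near=> n; split; [by near: n; exact: nbhs_infty_gt| |].
    by rewrite -lte_fin; near: n.
  by rewrite -lte_fin; near: n.
have c20 : 0 < c2.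
  have [n [n0 X1 X2]] := filter_ex spec.
  have pn0 : (0 < p n)%N.
    rewrite lt0n; apply/eqP => pn0; move: X1; rewrite lambda_min0//.
    by rewrite ltNge ltW.
  apply: lt_trans hc1 (lt_trans X1 (le_lt_trans _ X2)).
  exact: lambda_min_le_max (gram_sym _ _).
(* [n * kap] is [lo * eps ^+ 2] for the lower design constant [lo = n * c1 / d2]; every exponent
   below is measured against it. *)
set kap := eps ^+ 2 * c1 / d2.
have kap0 : 0 < kap by rewrite divr_gt0// mulr_gt0// exprn_gt0.
have sd1 : 0 < Num.sqrt d1 by rewrite sqrtr_gt0.
have sc2 : 0 < Num.sqrt c2 by rewrite sqrtr_gt0.
set A := Num.sqrt c2 / Num.sqrt d1.
have A0 : 0 < A by rewrite divr_gt0.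
have A2 : A ^+ 2 = c2 / d1 by rewrite expr_div_n !sqr_sqrtr// ltW.
(* The bounds [1] and [kap / 100] on [A * Delta] control the quadratic term near [B0] and meet the
   prior condition with [k = kap / 64]; the bound [eps / 4] controls the linear term. *)
set Delta := Num.min (Num.min 1 (kap / 100) / A) (eps / 4).
have Delta0 : 0 < Delta.
  by rewrite /Delta !lt_min divr_gt0//= ?divr_gt0// lt_min ltr01 divr_gt0.
have AD1 : A * Delta <= 1.
  by rewrite mulrC -ler_pdivlMr// /Delta ge_min ler_pM2r ?invr_gt0// ge_min lexx.
have ADk : A * Delta <= kap / 100.
  rewrite mulrC -ler_pdivlMr// /Delta ge_min ler_pM2r ?invr_gt0// ge_min lexx.
  by rewrite orbT.
have De : Delta <= eps / 4 by rewrite /Delta ge_min lexx orbT.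
have [rho rho0 Hprior] := hprior.
have {}Hprior := Hprior Delta Delta0.
have Delta_lt : Delta < eps ^+ 2 * c1 * Num.sqrt d1 / (48 * Num.sqrt c2 * d2).
  have -> : eps ^+ 2 * c1 * Num.sqrt d1 / (48 * Num.sqrt c2 * d2) = kap / 48 / A.
    by rewrite /kap /A; field; rewrite !gt_eqF.
  by rewrite ltr_pdivlMr// mulrC (le_lt_trans ADk)//; lra.
have k_lt : kap / 64 <
    eps ^+ 2 * c1 / (32 * d2) - 3 * Delta * Num.sqrt c2 / (2 * Num.sqrt d1).
  have -> : eps ^+ 2 * c1 / (32 * d2) - 3 * Delta * Num.sqrt c2 / (2 * Num.sqrt d1)
     = kap / 32 - 3 / 2 * (A * Delta).
    by rewrite /kap /A; field; rewrite !gt_eqF.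
  lra.
have k0 : 0 < kap / 64 by lra.
have {}Hprior := Hprior Delta_lt (kap / 64) k0 k_lt.
(* [n * g] is [lo * eps / 4], the largest score that [posterior_prob_le_score] tolerates. *)
set g := c1 * eps / (4 * d2).
have g0 : 0 < g by rewrite divr_gt0 ?mulr_gt0.
set beta := g ^+ 2 / (8 * (c2 / d1)).
have beta0 : 0 < beta.
  apply: (divr_gt0 (exprn_gt0 2 g0)); apply: mulr_gt0 => //; exact: divr_gt0.
(* The error law on the whole space normalizes the density for every number of rows: at [n] for the
   errors, at [p n] for the Gaussian weight on coefficients. *)
have dens1 n : (\int[lam n q]_Y (mn_density 0 1%:M Sigma Y)%:E = 1)%E.
  by rewrite -hElaw// preimage_setT probability_setT.
pose F n := E n @^-1` [set Y : MX R n q | n%:R * g < frob (score Sigma (X n) Y)].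
have mF0 n : measurable [set Y : MX R n q | n%:R * g < frob (score Sigma (X n) Y)].
  exact: measurable_score_gt.
have mF n : measurable (F n).
  by rewrite /F -[X in measurable X]setTI; exact: hEmeas.
have hpq : \forall n \near \oo, (p n * q)%:R <= n%:R * beta.
  have q0 : 0 < q%:R :> R by rewrite ltr0n.
  have bq : 0 < beta / q%:R by rewrite divr_gt0.
  near=> n.
  have n0 : 0 < n%:R :> R by rewrite ltr0n; near: n; exact: nbhs_infty_gt.
  have : (p n)%:R / n%:R < beta / q%:R.
    by near: n; exact: (cvgr_lt (0 : R) hA1o).
  rewrite ltr_pdivrMr// mulrAC ltr_pdivlMr// natrM [leRHS]mulrC.
  exact: ltW.
have PF : \forall n \near \oo, (P (F n) <= (expR (- beta) ^+ n)%:E)%E.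
  near=> n; have [n0 X1 X2] : [/\ (0 < n)%N,
    c1 < lambda_min (n%:R^-1 *: ((X n)^T *m X n)) &
    lambda_max (n%:R^-1 *: ((X n)^T *m X n)) < c2] by near: n.
  have Xb := design_bounds hSigma hd1 hA3min d20 hA3max n0 X1 X2.
  rewrite /F hElaw; last exact: mF0.
  apply: (score_event_bound (hlam n q) (hlam (p n) q)
    hSigma hd1 hA3min hA3max d20 (dens1 n) (dens1 (p n)) n0 (divr_gt0 c20 hd1)
    (ltW g0)).
    by move=> D; have /andP[_] := Xb D; rewrite mulrA.
  by near: n.
have x1 (y : R) : 0 < y -> expR (- y) < 1 by move=> y0; rewrite expR_lt1 oppr_lt0.
have bc := borel_cantelli_geometric mF (expR_gt0 (- beta)) (x1 beta beta0) PF.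
move: bc; apply: filterS => w Fw.
apply: (@squeeze_cvgr _ _ _ _ (fun=> 0) (fun n => expR (- (kap / 8)) ^+ n)).
- near=> n; have [n0 X1 X2] : [/\ (0 < n)%N,
    c1 < lambda_min (n%:R^-1 *: ((X n)^T *m X n)) &
    lambda_max (n%:R^-1 *: ((X n)^T *m X n)) < c2] by near: n.
  have n0' : 0 < n%:R :> R by rewrite ltr0n.
  have Xb := design_bounds hSigma hd1 hA3min d20 hA3max n0 X1 X2.
  have nFw : frob (score Sigma (X n) (E n w)) <= n%:R * g.
    by rewrite leNgt; apply/negP; have : ~ F n w by near: n.
  have den1 : 1 <= n%:R `^ (rho / 2).
    rewrite -[leLHS](powRr0 n%:R); rewrite ler_powR ?ler1n//.
    by rewrite ltW// divr_gt0.
  set del := Delta / n%:R `^ (rho / 2).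
  have del0 : 0 < del by rewrite divr_gt0// (lt_le_trans ltr01).
  have delD : del <= Delta.
    by rewrite ler_pdivrMr ?(lt_le_trans ltr01)// ler_peMr// ltW.
  have mass : ((expR (- (kap / 64 * n%:R)))%:E < prior_prob (lam (p n) q) (pi_ n)
      [set B : MX R (p n) q | (frob (B - B0 n) < del)%R])%E.
    by rewrite /del; near: n; exact: Hprior.
  have lo0 : 0 <= n%:R * c1 / d2 by rewrite divr_ge0 ?mulr_ge0 ?ltW.
  have hi0 : 0 <= n%:R * c2 / d1 by rewrite divr_ge0 ?mulr_ge0 ?ltW.
  have gle : n%:R * g <= n%:R * c1 / d2 * eps / 4.
    by rewrite le_eqVlt; apply/orP; left; apply/eqP; rewrite /g; field; rewrite gt_eqF.
  have /andP[post0 postle] := posterior_prob_le_score (E := E n w) (hpi_meas n)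
    (hpi_ge0 n) (hpi_1 n) hSigma Xb hi0 lo0 heps nFw gle
    (expR_gt0 (- (kap / 64 * n%:R))) mass.
  apply/andP; split; first exact: post0.
  apply: (le_trans postle).
  rewrite -expRN opprK -expRD -expRM_natl ler_expR.
  have -> : n%:R * c2 / d1 = n%:R * A ^+ 2 by rewrite A2 mulrA.
  have -> : n%:R * c1 / d2 * eps ^+ 2 = n%:R * kap.
    by rewrite /kap; field; rewrite gt_eqF.
  have dg : del * g <= kap / 16.
    apply: (@le_trans _ _ (eps / 4 * g)).
      by apply: ler_wpM2r; [exact: ltW|exact: le_trans De].
    rewrite le_eqVlt; apply/orP; left; apply/eqP.
    by rewrite /g /kap; field; rewrite gt_eqF.
  have dA : A ^+ 2 * del ^+ 2 <= kap / 100.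
    rewrite -exprMn; apply: (@le_trans _ _ (A * Delta)) => //.
    have Ad : A * del <= A * Delta by rewrite ler_pM2l.
    have Ad0 : 0 <= A * del by rewrite mulr_ge0 ?ltW.
    by rewrite expr2 (le_trans _ Ad)// ler_piMr// (le_trans Ad).
  (* The bracket is at most [(1/16 + 1/200 - 1/4 + 1/64) * kap], which is below [- kap / 8]. *)
  rewrite [leLHS](_ : _ = n%:R * (del * g + A ^+ 2 * del ^+ 2 / 2 - kap / 4 + kap / 64)).
    by apply: ler_wpM2l; [exact: ltW|lra].
  by field.
- exact: cvg_cst.
- apply: cvg_expr; rewrite ger0_norm ?expR_ge0//; apply: x1.
  by rewrite divr_gt0.
Unshelve. all: by end_near. Qed.
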